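(* The augmented chain complex $E_\bullet$ is well-defined. That is, the recursive clauses given in the context unambiguously define $\mathrm{d}$ on every generator of $E_{n}$ for every $n>0$, and the resulting homomorphisms of abelian groups $\mathrm{d}\colon E_{n+1}\to E_n$ ($n\in\mathbb{N}$) and $\mathrm{e}\colon E_0\to\mathbb{Z}$ satisfy $\mathrm{e}\,\mathrm{d}=0$ and $\mathrm{d}\,\mathrm{d}=0$.
   Context: Here $\mathbb{N}$ includes $0$, $\mathbb{F}_2=\{0,1\}$ is the field with two elements (''bits'') with addition $\oplus$, $(-)^m$ denotes $(-1)^m$, and $\mathbb{Z}B$ is the free abelian group on a set $B$. Noncrossing partitions. A partition of degree $n$ is a partition $\{\pi_1,\dots,\pi_k\}$ of $\{1,\dots,n\}$ into non-empty blocks; it is noncrossing if for all $i,j$, all $a,a'\in\pi_i$, $b,b'\in\pi_j$, $a<b<a'<b'$ implies $i=j$. The empty partition $\{\}$ is the only partition of degree $0$. For $i,m\in\mathbb{N}$ let $\mathsf{s}_i^m\colon\mathbb{N}\to\mathbb{N}$ send $x\mapsto x$ if $x<i$ and $x\mapsto x+m$ if $x\ge i$. For noncrossing partitions $p=\{\pi_1,\dots,\pi_k\}$ of degree $n$, $q=\{\rho_1,\dots,\rho_\ell\}$ of degree $m$, and $i\in\{1,\dots,n+1\}$, set $p\circ_i q=\{\mathsf{s}_i^m(\pi_1),\dots,\mathsf{s}_i^m(\pi_k),\mathsf{s}_1^{i-1}(\rho_1),\dots,\mathsf{s}_1^{i-1}(\rho_\ell)\}$, a noncrossing partition of degree $n+m$.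 Polarised noncrossing partitions. A polarised noncrossing partition of degree $n$ is a pair $(p,b_1\cdots b_{n+1})$ (also written $(p,b_\bullet)$) of a noncrossing partition $p$ of degree $n$ and a string of $n+1$ bits; their set is $\mathrm{NCP}_{\mathbb{F}_2}(n)$. For $(p,b_\bullet)$ of degree $n$, $(q,c_\bullet)$ of degree $m$, $i\in\{1,\dots,n+1\}$, set $(p,b_\bullet)\circ_i(q,c_\bullet)=(p\circ_i q,\ b_1\cdots b_{i-1}(b_i\oplus c_1)\cdots(b_i\oplus c_{m+1})b_{i+1}\cdots b_{n+1})$. For $b\in\{0,1\}$ let $\psi_0^b=(\{\},b)$, and for $n>0$ let $\psi_n^b=(\{\{1,\dots,n\}\},b0\cdots0)$. Rightmost decomposition. Every polarised noncrossing partition has a unique factorisation of the form $(\dots((\psi_0^0\circ_{i_1}\psi_{m_1}^{c_1})\circ_{i_2}\psi_{m_2}^{c_2})\dots)\circ_{i_k}\psi_{m_k}^{c_k}$ with $k\ge0$, $i_1<\dots<i_k$, and, for each $j$, $m_j>0$ or $c_j=1$; it is called its rightmost decomposition and $k$ its length. Those of length at most $1$ are exactly the $\psi_m^c$. Definition of $E_\bullet$. An augmented chain complex is a chain complex of abelian groups in non-negative degrees with differential $\mathrm{d}$ together with a homomorphism $\mathrm{e}$ from degree $0$ to $\mathbb{Z}$ such that $\mathrm{e}\mathrm{d}=0$. Put $E_0=\mathbb{Z}\{s,t\}$, $E_{n+1}=\mathbb{Z}(\mathrm{NCP}_{\mathbb{F}_2}(n))$ for $n\in\mathbb{N}$, $\mathrm{e}s=\mathrm{e}t=1$.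 Define $\mathrm{d}$ on generators by induction on the length of the rightmost decomposition, extending $-\circ_i-$ bilinearly where necessary: $\mathrm{d}\psi_0^c=(-)^c(t-s)$; $\mathrm{d}\psi_{m+1}^c=\psi_m^{c\oplus1}+(-)^m\psi_m^c$. If the rightmost decomposition is $(p',b'_\bullet)\circ_i\psi_m^c$ with $\psi_m^c$ its final factor and $p'$ of degree $k>0$, then: - if $i=k+1$: $\mathrm{d}((p',b'_\bullet)\circ_i\psi_0^1)=-\mathrm{d}(p',b'_\bullet)$ and $\mathrm{d}((p',b'_\bullet)\circ_i\psi_{m+1}^c)=(p',b'_\bullet)\circ_i\mathrm{d}\psi_{m+1}^c$; - if $i<k+1$: $\mathrm{d}((p',b'_\bullet)\circ_i\psi_0^1)=\mathrm{d}(p',b'_\bullet)\circ_i\psi_0^1$ and $\mathrm{d}((p',b'_\bullet)\circ_i\psi_{m+1}^c)=\mathrm{d}(p',b'_\bullet)\circ_i\psi_{m+1}^c+(-)^{k+1-i}(p',b'_\bullet)\circ_i\mathrm{d}\psi_{m+1}^c$. *)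

(* Defs.v *)
From HB Require Import structures.
From mathcomp Require Import all_boot all_order all_algebra.
From mathcomp Require Import finmap zify.
From mathcomp Require Export freeg.

Set Implicit Arguments.
Unset Strict Implicit.
Unset Printing Implicit Defensive.

Import GRing.Theory.

Local Open Scope fset_scope.

Definition is_partition (n : nat) (P : {fset {fset nat}}) : bool :=
  [&& fset0 \notin P, trivIfset P & fcover P == [fset x in iota 1 n]].

Definition noncrossing (P : {fset {fset nat}}) : bool :=
  [forall A : P, forall B : P,
    [forall a : val A, forall a' : val A, forall b : val B, forall b' : val B,
      [&& val a < val b, val b < val a' & val a' < val b'] ==> (A == B)]].

Definition is_ncp (n : nat) (P : {fset {fset nat}}) : bool :=
  is_partition n P && noncrossing P.

Definition ncp (n : nat) : choiceType := {P : {fset {fset nat}} | is_ncp n P}.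

Definition shift (i m x : nat) : nat := if x < i then x else (x + m)%N.

Definition shift_block (i m : nat) (A : {fset nat}) : {fset nat} :=
  [fset shift i m x | x in A].

Definition comp_blocks (i m : nat) (P Q : {fset {fset nat}}) :
    {fset {fset nat}} :=
  [fset shift_block i m A | A in P] `|` [fset shift_block 1 i.-1 B | B in Q].

Lemma noncrossingP (P : {fset {fset nat}}) :
  reflect (forall A B, A \in P -> B \in P ->
             forall a a' b b', a \in A -> a' \in A -> b \in B -> b' \in B ->
             a < b -> b < a' -> a' < b' -> A = B)
          (noncrossing P).
Proof.
apply: (iffP forallP) => [ncP A B AP BP a a' b b' aA a'A bB b'B ab ba ab'|ncP A].
  have /forallP/(_ [` BP])/forallP/(_ [` aA])/forallP/(_ [` a'A]) := ncP [` AP].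
  move=> /forallP/(_ [` bB])/forallP/(_ [` b'B]) /=.
  by rewrite ab ba ab' /= => /eqP/(congr1 val).
apply/forallP => B; apply/forallP => a; apply/forallP => a'.
apply/forallP => b; apply/forallP => b'; apply/implyP => /and3P[ab ba ab'].
apply/eqP/val_inj.
exact: (ncP _ _ (valP A) (valP B) _ _ _ _ (valP a) (valP a') (valP b) (valP b')).
Qed.

Lemma in_fcover (P : {fset {fset nat}}) x :
  reflect (exists2 A, A \in P & x \in A) (x \in fcover P).
Proof.
apply: (iffP (bigfcupP _ _ _ _)) => [[A /andP[AP _] xA]|[A AP xA]]; exists A => //.
by rewrite AP.
Qed.

Lemma in_interval n x : (x \in [fset x in iota 1 n]) = (0 < x <= n).
Proof. by rewrite inE /= mem_iota; lia. Qed.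

Lemma is_partitionP n (P : {fset {fset nat}}) :
  reflect [/\ fset0 \notin P,
              (forall A B x, A \in P -> B \in P -> x \in A -> x \in B -> A = B)
            & forall x, (0 < x <= n) <-> (exists2 A, A \in P & x \in A)]
          (is_partition n P).
Proof.
apply: (iffP and3P) => -[P0 tP cP]; split=> //.
- move=> A B x AP BP xA xB; apply/eqP/negPn/negP => neAB.
  have /fdisjointP/(_ x xA) := trivIfsetP _ tP _ _ AP BP neAB.
  by rewrite xB.
- move=> x; rewrite -in_interval -(eqP cP).
  by split => [/in_fcover|/in_fcover].
- apply/trivIfsetP => A B AP BP neAB; apply/fdisjointP => x xA.
  by apply: contra neAB => xB; apply/eqP; exact: tP xA xB.
- apply/eqP/fsetP => x; rewrite in_interval; apply/in_fcover/idP => /cP //.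
Qed.

Lemma ltn_shift i m x y : (shift i m x < shift i m y) = (x < y).
Proof. by rewrite /shift; do 2!case: ifP; lia. Qed.

Lemma shift_inj i m : injective (shift i m).
Proof. by move=> x y; rewrite /shift; do 2!case: ifP; lia. Qed.

Lemma shift_gap i m x : (shift i m x < i) || (i + m <= shift i m x)%N.
Proof. by rewrite /shift; case: ifP; lia. Qed.

Lemma shift1_bounds i m x : 0 < i -> 0 < x <= m ->
  (i <= shift 1 i.-1 x) && (shift 1 i.-1 x < i + m)%N.
Proof. by rewrite /shift; case: ifP; lia. Qed.

Lemma is_ncp_comp n m i (P Q : {fset {fset nat}}) : 0 < i <= n.+1 ->
  is_ncp n P -> is_ncp m Q -> is_ncp (n + m)%N (comp_blocks i m P Q).
Proof.
move=> hi /andP[/is_partitionP[P0 tP cP] /noncrossingP nP].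
move=> /andP[/is_partitionP[Q0 tQ cQ] /noncrossingP nQ].
have i0 : 0 < i by case/andP: hi.
have Pin A x : A \in P -> x \in A -> 0 < x <= n by move=> *; apply/cP; exists A.
have Qin B x : B \in Q -> x \in B -> 0 < x <= m by move=> *; apply/cQ; exists B.
apply/andP; split.
  apply/is_partitionP; split.
  - rewrite inE; apply/norP; split; apply/imfsetP => -[A /= AP] /esym A0.
      case: (fset_0Vmem A) => [A0'|[x xA]]; first by rewrite A0' in AP; case/negP: P0.
      have : shift i m x \in shift_block i m A by apply: in_imfset.
      by rewrite A0.
    case: (fset_0Vmem A) => [A0'|[x xA]]; first by rewrite A0' in AP; case/negP: Q0.
    have : shift 1 i.-1 x \in shift_block 1 i.-1 A by apply: in_imfset.
    by rewrite A0.
  - move=> _ _ x /fsetUP[]/imfsetP[A /= AP ->] /fsetUP[]/imfsetP[B /= BP ->];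
    move=> /imfsetP[a /= aA ->] /imfsetP[b /= bB eqab].
    + have ab := shift_inj eqab.
      by rewrite (tP A B a) // ab.
    + have := shift_gap i m a; have := shift1_bounds i0 (Qin _ _ BP bB).
      by rewrite eqab; clear; lia.
    + have := shift_gap i m b; have := shift1_bounds i0 (Qin _ _ AP aA).
      by rewrite eqab; clear; lia.
    + have ab := shift_inj eqab.
      by rewrite (tQ A B a) // ab.
  - move=> x; split=> [hx|[A /fsetUP[]/imfsetP[B /= BP ->] /imfsetP[b /= bB ->]]].
    + have inP y : 0 < y <= n -> x = shift i m y ->
          exists2 A, A \in comp_blocks i m P Q & x \in A.
        move=> /cP[A AP yA] ->; exists (shift_block i m A).
          by rewrite inE; apply/orP; left; apply: in_imfset.
        exact: in_imfset.
      have inQ y : 0 < y <= m -> x = shift 1 i.-1 y ->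
          exists2 A, A \in comp_blocks i m P Q & x \in A.
        move=> /cQ[A AP yA] ->; exists (shift_block 1 i.-1 A).
          by rewrite inE; apply/orP; right; apply: in_imfset.
        exact: in_imfset.
      case: (ltnP x i) => xi; first by apply: (inP x); rewrite /shift; try case: ifP; lia.
      case: (ltnP x (i + m)%N) => xim.
        by apply: (inQ (x - i.-1)%N); rewrite /shift; try case: ifP; lia.
      by apply: (inP (x - m)%N); rewrite /shift; try case: ifP; lia.
    + by have := Pin _ _ BP bB; rewrite /shift; case: ifP; lia.
    + by have := Qin _ _ BP bB; rewrite /shift; case: ifP; lia.
apply/noncrossingP => _ _ /fsetUP[]/imfsetP[A /= AP ->] /fsetUP[]/imfsetP[B /= BP ->];
move=> _ _ _ _ /imfsetP[a /= aA ->] /imfsetP[a' /= a'A ->]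
       /imfsetP[b /= bB ->] /imfsetP[b' /= b'B ->].
- by rewrite !ltn_shift => ab ba ab'; rewrite (nP A B AP BP a a' b b').
- have := shift1_bounds i0 (Qin _ _ BP bB).
  have := shift_gap i m a'; have := shift1_bounds i0 (Qin _ _ BP b'B).
  by clear; lia.
- have := shift1_bounds i0 (Qin _ _ AP aA).
  have := shift_gap i m b; have := shift1_bounds i0 (Qin _ _ AP a'A).
  by clear; lia.
- by rewrite !ltn_shift => ab ba ab'; rewrite (nQ A B AP BP a a' b b').
Qed.

Definition ncp_comp n m i (hi : 0 < i <= n.+1) (p : ncp n) (q : ncp m) :
    ncp (n + m)%N :=
  Sub (comp_blocks i m (val p) (val q)) (is_ncp_comp hi (valP p) (valP q)).

(* The one-block partition, read as the empty partition in degree 0. *)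
Definition full_blocks (n : nat) : {fset {fset nat}} :=
  if n is 0 then fset0 else [fset [fset x in iota 1 n]].

Lemma is_ncp_full n : is_ncp n (full_blocks n).
Proof.
case: n => [|n].
  apply/andP; split; last by apply/noncrossingP.
  by apply/is_partitionP; split => // x; split => [|[]//]; lia.
rewrite /full_blocks; set I := [fset x in iota 1 n.+1].
have inI (x : nat) : (x \in I) = (0 < x <= n.+1) by exact: in_interval.
apply/andP; split.
  apply/is_partitionP; split.
  - rewrite inE; apply/eqP => I0; have := inI 1; rewrite -I0 inE; lia.
  - by move=> A B x /fset1P -> /fset1P ->.
  - move=> x; split => [hx|[A /fset1P -> ]]; last by rewrite inI.
    by exists I; rewrite ?inI ?fset11.
by apply/noncrossingP => A B /fset1P -> /fset1P ->.
Qed.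

Definition ncp_full n : ncp n := Sub (full_blocks n) (is_ncp_full n).

(* Polarised noncrossing partitions; [bool] is the field with two elements,
   with addition [(+)].  Positions [i] are counted from 1 as in the blocks, so
   the [i]-th bit of [b] is [nth false b i.-1]. *)

Definition pncp (n : nat) : choiceType := (ncp n * n.+1.-tuple bool)%type.

Definition comp_bits (i : nat) (b c : seq bool) : seq bool :=
  take i.-1 b ++ [seq nth false b i.-1 (+) x | x <- c] ++ drop i b.

Lemma size_comp_bits n m i (b : n.+1.-tuple bool) (c : m.+1.-tuple bool) :
  0 < i <= n.+1 -> size (comp_bits i b c) == (n + m)%N.+1.
Proof.
move=> hi; rewrite /comp_bits !size_cat size_map size_drop size_take !size_tuple.
by case: ifP; lia.
Qed.

Definition pncp_comp n m i (hi : 0 < i <= n.+1) (x : pncp n) (y : pncp m) :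
    pncp (n + m)%N :=
  (ncp_comp hi x.1 y.1, Tuple (size_comp_bits x.2 y.2 hi)).

Definition psi (n : nat) (b : bool) : pncp n :=
  (ncp_full n, [tuple of b :: nseq n false]).

(* A list [(i_1, m_1, c_1); ..; (i_k, m_k, c_k)] encodes the iterated composite
   (..(psi 0 0 o_(i_1) psi m_1 c_1)..) o_(i_k) psi m_k c_k. *)
Inductive rightmost_decomposition :
    forall n, pncp n -> seq (nat * nat * bool) -> Prop :=
| RightmostNil : rightmost_decomposition (psi 0 false) [::]
| RightmostRcons n (p : pncp n) l i m c (hi : 0 < i <= n.+1) :
    rightmost_decomposition p l ->
    all (fun f : nat * nat * bool => f.1.1 < i) l ->
    (0 < m) || c ->
    rightmost_decomposition (pncp_comp hi p (psi m c)) (rcons l (i, m, c)).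

(* [p o_i psi m c] is the outermost composition of a rightmost decomposition,
   with [psi m c] as its final factor. *)
Definition final_factor n i (hi : 0 < i <= n.+1) (p : pncp n) m c : Prop :=
  exists2 l, rightmost_decomposition p l
           & rightmost_decomposition (pncp_comp hi p (psi m c)) (rcons l (i, m, c)).

Local Open Scope ring_scope.

Definition is_augmented_chain_complex (C : nat -> zmodType)
    (d : forall n, {additive C n.+1 -> C n}) (e : {additive C 0%N -> int}) :=
  (forall u, e (d 0%N u) = 0) /\ (forall n u, d n (d n.+1 u) = 0).

Variant endpoint := es | et.

Definition bool_of_endpoint x := if x is et then true else false.
Definition endpoint_of_bool (b : bool) := if b then et else es.
Lemma bool_of_endpointK : cancel bool_of_endpoint endpoint_of_bool.
Proof. by case. Qed.
HB.instance Definition _ := Choice.copy endpoint (can_type bool_of_endpointK).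

Definition basis (n : nat) : choiceType :=
  if n is n'.+1 then pncp n' else endpoint.

Definition E (n : nat) : lmodType int := {freeg (basis n) / int}.

Definition gen n (x : basis n) : E n := << x >>.

Definition pgen n (x : pncp n) : E n.+1 := @gen n.+1 x.

Definition castE m n (eq_mn : m = n) (u : E m) : E n := ecast k (E k) eq_mn u.

Definition extend n (M : lmodType int) (f : basis n -> M) (u : E n) : M :=
  fglift f u.

Lemma extend_is_additive n (M : lmodType int) (f : basis n -> M) :
  zmod_morphism (extend f).
Proof. exact: lift_is_additive. Qed.

HB.instance Definition _ n (M : lmodType int) (f : basis n -> M) :=
  GRing.isZmodMorphism.Build (E n) M (extend f) (extend_is_additive f).

Definition ecomp n m i (hi : (0 < i <= n.+1)%N) (u : E n.+1) (v : E m.+1) :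
    E (n + m)%N.+1 :=
  @extend n.+1 _
    (fun x : pncp n => @extend m.+1 _ (fun y : pncp m => pgen (pncp_comp hi x y)) v) u.

Definition augmentation : {additive E 0 -> int} :=
  (@extend 0 int^o (fun=> 1) : {additive E 0 -> int^o}).

Definition differential (d : forall n, pncp n -> E n) (n : nat) :
    {additive E n.+1 -> E n} :=
  @extend n.+1 (E n) (d n).

(* [p] has positive degree [k.+1], so its last position is [k.+2]; [castE] only
   transports along [k.+1 + 0 = k.+1] and [k.+1 + m.+1 = (k.+1 + m).+1]. *)
Record differential_clauses (d : forall n, pncp n -> E n) : Prop := {
  d_psi0 (c : bool) :
    d 0%N (psi 0 c) = (-1) ^+ c *: (@gen 0 et - @gen 0 es);
  d_psiS (m : nat) (c : bool) :
    d m.+1 (psi m.+1 c) = pgen (psi m (c (+) true)) + (-1) ^+ m *: pgen (psi m c);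
  d_last_psi0 (k : nat) (p : pncp k.+1) (hi : (0 < k.+2 <= k.+2)%N) :
    final_factor hi p 0 true ->
    d (k.+1 + 0)%N (pncp_comp hi p (psi 0 true))
      = castE (esym (addn0 k.+1)) (- d k.+1 p);
  d_last_psiS (k m : nat) (c : bool) (p : pncp k.+1)
      (hi : (0 < k.+2 <= k.+2)%N) :
    final_factor hi p m.+1 c ->
    d (k.+1 + m.+1)%N (pncp_comp hi p (psi m.+1 c))
      = castE (esym (addnS k.+1 m)) (ecomp hi (pgen p) (d m.+1 (psi m.+1 c)));
  d_inner_psi0 (k i : nat) (p : pncp k.+1)
      (hi : (0 < i <= k.+2)%N) (hi' : (0 < i <= k.+1)%N) :
    final_factor hi p 0 true ->
    d (k.+1 + 0)%N (pncp_comp hi p (psi 0 true))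
      = ecomp hi' (d k.+1 p) (pgen (psi 0 true));
  d_inner_psiS (k m i : nat) (c : bool) (p : pncp k.+1)
      (hi : (0 < i <= k.+2)%N) (hi' : (0 < i <= k.+1)%N) :
    final_factor hi p m.+1 c ->
    d (k.+1 + m.+1)%N (pncp_comp hi p (psi m.+1 c))
      = ecomp hi' (d k.+1 p) (pgen (psi m.+1 c))
        + (-1) ^+ (k.+2 - i)
          *: castE (esym (addnS k.+1 m)) (ecomp hi (pgen p) (d m.+1 (psi m.+1 c)))
}.

(* Main.v *)
Require Import Defs.
From mathcomp Require Import all_boot all_algebra.
From mathcomp Require Import finmap zify.

Set Implicit Arguments.
Unset Strict Implicit.
Unset Printing Implicit Defensive.

Import GRing.Theory.

(** Why the complex is well defined.

    Since the positions of a rightmost decomposition increase strictly, a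
    factor is always inserted at a gap whose bit is still 0, and it never moves
    or changes anything on the left of that gap.  Hence a polarised noncrossing
    partition of degree n is the same thing as a word of n+1 letters (m, c),
    the letter at gap g recording the size m of the block with minimum g (0 if
    there is none) together with the bit c of the gap; the rightmost
    decomposition lists the letters other than the blank (0, 0).  The words
    that occur are the Lukasiewicz words: each letter sits at a gap that exists
    when it is inserted, so a proper prefix u has height
    h(u) = weight u - size u >= 0, and the whole word has height -1.  The
    bijection is [decode_inj] and [decode_surj]; the latter strips the block
    with the largest minimum, which the noncrossing condition forces to be an
    interval ([last_block_interval]).

    On words the recursive clauses become one formula.  With
    delta(m+1, c) = (m, c+1) + (-1)^m (m, c) and delta(0, c) = 0, put
      D(u a) = [h(u) > 0] D(u) a + (-1)^(h(u)) u delta(a).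
    A complete word of positive degree is u (0, c) with h(u) = 0, and
    d(u (0, c)) = (-1)^c D(u).  That this d satisfies the clauses is
    [diff_clauses]; that the clauses leave no choice follows by induction on
    the word, as every word spells an iterated composite in rightmost form
    ([differential_clauses_unique]).

    Terms of D(u) have height h(u) - 1, so expanding D(D(u a)) for h(u) > 0
    gives D(u) delta(a) twice with opposite signs and u delta(delta(a)) = 0,
    and leaves only [h(u) > 1] D(D(u)) a; thus D D = 0 by induction
    ([boundaryK]).  Finally d d (u (0, c)) is, up to sign, d(D(u)) where
    h(u) = 0.  Write u = u' a.  If h(u') > 0 then a = (0, c') and
    d(D(u') a) = (-1)^(c') D(D(u')) = 0; if h(u') = 0 then a = (1, c'), and the
    two terms u' (0, c'+1) and u' (0, c') of D(u) have opposite images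
    ([boundary_word_diff]). *)

Local Open Scope fset_scope.
Local Open Scope nat_scope.

(** * Words *)

Definition letter := (nat * bool)%type.

(** A word is stored from right to left: the head of the list is its last
    letter, so that consing a letter is composing with a last factor. *)
Definition word := seq letter.

Definition blank : letter := (0, false).

Definition weight (w : word) : nat := sumn (unzip1 w).

Lemma weight_cons m c u : weight ((m, c) :: u) = weight u + m.
Proof. exact: addnC. Qed.

(** The letter that follows u is inserted at position [(size u).+1], which
    must be one of the [(weight u).+1] gaps available. *)
Fixpoint admissible (w : word) : bool :=
  if w is _ :: u then admissible u && (size u <= weight u) else true.

(** A blank stands for composing with the neutral element [psi 0 false], so
    padding does not change the partition that is spelled. *)
Definition pad r (w : word) : word := nseq r blank ++ w.

Lemma size_pad r w : size (pad r w) = r + size w.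
Proof. by rewrite size_cat size_nseq. Qed.

Lemma weight_pad r w : weight (pad r w) = weight w.
Proof. by elim: r. Qed.

Lemma padS r w : pad r.+1 w = blank :: pad r w.
Proof. by []. Qed.

Lemma admissible_pad r w :
  admissible w -> r + size w <= (weight w).+1 -> admissible (pad r w).
Proof.
move=> aw; elim: r => [|r IH] // le_r.
rewrite padS /= IH 1?size_pad 1?weight_pad //; lia.
Qed.

(** * The polarised partition spelled by a word *)

Fixpoint blocks (w : word) : {fset {fset nat}} :=
  if w is a :: u then comp_blocks (size u).+1 a.1 (blocks u) (full_blocks a.1)
  else fset0.

Lemma shift0 i x : shift i 0 x = x.
Proof. by rewrite /shift addn0 if_same. Qed.

Lemma shift_block0 i (A : {fset nat}) : shift_block i 0 A = A.
Proof.
apply/fsetP => x; apply/imfsetP/idP => [[y /= yA ->]|xA].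
  by rewrite shift0.
by exists x => //; rewrite shift0.
Qed.

Lemma mem_shift_block i m (A : {fset nat}) x :
  (shift i m x \in shift_block i m A) = (x \in A).
Proof. by rewrite mem_imfset //; exact: shift_inj. Qed.

Lemma shift_block_inj i m : injective (shift_block i m).
Proof.
move=> A B eqAB; apply/fsetP => x.
by rewrite -(mem_shift_block i m A) eqAB mem_shift_block.
Qed.

Lemma comp_blocks0 i (P : {fset {fset nat}}) : comp_blocks i 0 P fset0 = P.
Proof.
rewrite /comp_blocks imfset0 fsetU0.
apply/fsetP => A; apply/imfsetP/idP => [[B /= BP ->]|AP].
  by rewrite shift_block0.
by exists A => //; rewrite shift_block0.
Qed.

Lemma blocks_pad r w : blocks (pad r w) = blocks w.
Proof. by elim: r => //= r <-; rewrite comp_blocks0. Qed.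

Lemma is_ncp_blocks w : admissible w -> is_ncp (weight w) (blocks w).
Proof.
elim: w => [|a u IH] /=; first by move=> _; exact: (is_ncp_full 0).
case/andP=> au le_u; rewrite [weight _](addnC a.1).
by apply: is_ncp_comp; rewrite ?is_ncp_full ?IH.
Qed.

(** Missing letters are read as blanks, so that a word and its paddings spell
    the same bits; the default of [insubd] is reached only by words that are
    not admissible of weight n. *)
Definition decode n (w : word) : pncp n :=
  (insubd (ncp_full n) (blocks w),
   [tuple (nth blank (rev w) i).2 | i < n.+1]).

Lemma val_decode n w : admissible w -> weight w = n ->
  val (decode n w).1 = blocks w.
Proof. by move=> aw <-; rewrite insubdK // [_ \in _]is_ncp_blocks. Qed.

Lemma nth_decode n w i : i < n.+1 ->
  nth false (decode n w).2 i = (nth blank (rev w) i).2.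
Proof. by move=> lt_i; rewrite -(tnth_nth _ _ (Ordinal lt_i)) tnth_mktuple. Qed.

Lemma nth_pad r w i : nth blank (rev (pad r w)) i = nth blank (rev w) i.
Proof.
rewrite rev_cat nth_cat; case: ltnP => // le_i.
by rewrite [RHS]nth_default // rev_nseq nth_nseq if_same.
Qed.

Lemma decode_pad n r w : decode n (pad r w) = decode n w.
Proof.
rewrite /decode blocks_pad; congr pair.
by apply: eq_from_tnth => i; rewrite !tnth_mktuple nth_pad.
Qed.

Lemma pncp_eqP n (x y : pncp n) : val x.1 = val y.1 ->
  (forall i, i < n.+1 -> nth false x.2 i = nth false y.2 i) -> x = y.
Proof.
case: x y => [p b] [q c] /= eq_pq eq_bc; congr pair; first exact: val_inj.
by apply: eq_from_tnth => i; rewrite !(tnth_nth false) eq_bc.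
Qed.

Lemma psiE m c : psi m c = decode m [:: (m, c)].
Proof.
apply: pncp_eqP => [|i lt_i]; last first.
  by rewrite nth_decode //; case: i lt_i => //= i; rewrite nth_nseq nth_nil if_same.
rewrite val_decode //=; last exact: addn0.
rewrite /comp_blocks imfset0 fset0U.
apply/fsetP => A; apply/idP/imfsetP => [AP|[B /= BP ->]].
  by exists A; rewrite //= shift_block0.
by rewrite /= shift_block0.
Qed.

(** The bit at gap i of [decode n u] is blank because u has only i-1 letters;
    this is why composing with [psi m c] there writes c followed by zeros and
    just adds a letter. *)
Lemma pncp_comp_decode n m i (hi : 0 < i <= n.+1) u c :
  admissible u -> weight u = n -> size u = i.-1 ->
  pncp_comp hi (decode n u) (psi m c) = decode (n + m) ((m, c) :: u).
Proof.
move=> au wu su.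
have [i_gt0 le_i] := andP hi; have le_u : size u <= weight u by rewrite su wu; lia.
apply: pncp_eqP => [|j lt_j].
  rewrite [RHS]val_decode /= ?au //; last by rewrite -wu addnC.
  rewrite -/(val (decode n u).1) val_decode // su prednK //; lia.
have nth_u l : i.-1 <= l -> (nth blank (rev u) l).2 = false.
  by move=> le_l; rewrite nth_default // size_rev su.
rewrite nth_decode // rev_cons nth_rcons size_rev su.
have := nth_decode (n := n) u; have := size_tuple (decode n u).2.
have -> : (pncp_comp hi (decode n u) (psi m c)).2
    = comp_bits i (decode n u).2 (c :: nseq m false) :> seq bool by [].
move: (tval _) => b size_b nth_b; rewrite /comp_bits.
rewrite nth_cat size_takel ?size_b; last by lia.
case: ltnP => [lt_ji|le_ij]; first by rewrite nth_take // nth_b //; lia.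
rewrite nth_b ?nth_u //=; last by lia.
have [-> |ne_j] := eqVneq j i.-1; first by rewrite subnn.
have -> : j - i.-1 = (j - i).+1 by lia.
rewrite /= nth_cat size_map size_nseq nth_drop.
case: ltnP => [lt_jm|le_mj].
  by rewrite (nth_map false) ?size_nseq // nth_nseq if_same.
by rewrite nth_b ?nth_u //; lia.
Qed.

(** * A word is determined by the partition that it spells *)

Definition is_min (g : nat) (A : {fset nat}) : Prop :=
  g \in A /\ forall x, x \in A -> g <= x.

Lemma is_min_shift i m g (A : {fset nat}) :
  is_min (shift i m g) (shift_block i m A) <-> is_min g A.
Proof.
have le_shift x y : (shift i m x <= shift i m y) = (x <= y).
  by rewrite leqNgt ltn_shift -leqNgt.
split=> -[gA min_g]; split.
- by rewrite mem_shift_block in gA.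
- by move=> x xA; rewrite -le_shift; apply: min_g; rewrite mem_shift_block.
- by rewrite mem_shift_block.
- by move=> _ /imfsetP[x /= xA ->]; rewrite le_shift min_g.
Qed.

Lemma mem_full_blocks m A :
  A \in full_blocks m -> 0 < m /\ A = [fset x in iota 1 m].
Proof. by case: m => [|m]; rewrite !inE // => /eqP ->. Qed.

Lemma interval_full_block m : 0 < m -> [fset x in iota 1 m] \in full_blocks m.
Proof. by case: m => // m _; rewrite inE. Qed.

Lemma is_min_interval m : 0 < m -> is_min 1 [fset x in iota 1 m].
Proof.
move=> m_gt0; split; first by rewrite in_interval.
by move=> x; rewrite in_interval => /andP[].
Qed.

Lemma is_min_uniq g h A : is_min g A -> is_min h A -> g = h.
Proof.
move=> [gA min_g] [hA min_h]; apply/eqP.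
by rewrite eqn_leq min_g // min_h.
Qed.

(** Together with [ex_min_block], this recovers the first components of the
    letters from the blocks, and hence the injectivity of [decode]. *)
Lemma card_min_block w A g : A \in blocks w -> is_min g A ->
  #|` A| = (nth blank (rev w) g.-1).1.
Proof.
elim: w A g => [|a u IH] A g //= /fsetUP[]/imfsetP[B /= BP ->] gA.
  have /imfsetP[x /= xB eq_g] := gA.1.
  rewrite eq_g is_min_shift in gA.
  rewrite card_imfset; last exact: shift_inj.
  have eq_card := IH _ _ BP gA; rewrite eq_card.
  have lt_x : x.-1 < size u.
    rewrite ltnNge; apply/negP => le_x; move: eq_card.
    rewrite nth_default ?size_rev //= => /cardfs0_eq B0.
    by rewrite B0 in xB.
  rewrite eq_g /shift ifT; last by lia.
  by rewrite rev_cons nth_rcons size_rev lt_x.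
have [a_gt0 eqB] := mem_full_blocks BP; rewrite {}eqB in gA *.
have /(is_min_uniq gA) -> :
    is_min (size u).+1 (shift_block 1 (size u) [fset x in iota 1 a.1]).
  have /(is_min_shift 1 (size u) 1) := is_min_interval a_gt0.
  by rewrite {1}/shift ltnn add1n.
rewrite card_imfset; last exact: shift_inj.
rewrite card_fseq undup_id ?iota_uniq // size_iota.
by rewrite rev_cons nth_rcons size_rev ltnn eqxx.
Qed.

Lemma ex_min_block w g : 0 < g -> 0 < (nth blank (rev w) g.-1).1 ->
  exists2 A, A \in blocks w & is_min g A.
Proof.
move=> g_gt0; elim: w => [|a u IH]; first by rewrite nth_nil.
rewrite rev_cons nth_rcons size_rev.
case: (ltnP g.-1) => [lt_g /IH[A AP minA]|le_g].
  exists (shift_block (size u).+1 a.1 A).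
    by rewrite inE in_imfset.
  suff {1}-> : g = shift (size u).+1 a.1 g by apply/is_min_shift.
  by rewrite /shift ifT //; lia.
case: eqP => // eq_g a_gt0.
exists (shift_block 1 (size u) [fset x in iota 1 a.1]).
  rewrite inE; apply/orP; right; apply: in_imfset.
  exact: interval_full_block.
have -> : g = shift 1 (size u) 1 by rewrite /shift ltnn; lia.
exact/is_min_shift/is_min_interval.
Qed.

Lemma decode_inj n w w' :
  admissible w -> weight w = n -> size w = n.+1 ->
  admissible w' -> weight w' = n -> size w' = n.+1 ->
  decode n w = decode n w' -> w = w'.
Proof.
move=> aw ww sw aw' ww' sw' eq_dec.
have eq_blocks : blocks w = blocks w'.
  by rewrite -(val_decode aw ww) -(val_decode aw' ww') eq_dec.
apply: (can_inj revK); apply: (@eq_from_nth _ blank) => [|i].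
  by rewrite !size_rev sw sw'.
rewrite size_rev sw => lt_i.
rewrite [LHS]surjective_pairing [RHS]surjective_pairing; congr pair; last first.
  by rewrite -!(nth_decode (n := n)) // eq_dec.
have [z | nz] := posnP (nth blank (rev w) i).1.
  have [z' | nz'] := posnP (nth blank (rev w') i).1; first by rewrite z z'.
  have [A AP minA] := ex_min_block (ltn0Sn i) nz'.
  rewrite -(card_min_block AP minA) (card_min_block (w := w) _ minA) //.
  by rewrite eq_blocks.
have [A AP minA] := ex_min_block (ltn0Sn i) nz.
rewrite -(card_min_block AP minA) (card_min_block (w := w') _ minA) //.
by rewrite -eq_blocks.
Qed.

(** * Every polarised noncrossing partition is spelled by a word *)

(** The converse of [is_ncp_comp] for the left factor: what remains after an
    interval block is removed is still a noncrossing partition. *)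
Lemma is_ncp_comp_left n m i (P : {fset {fset nat}}) : 0 < i <= n.+1 ->
  is_ncp (n + m) (comp_blocks i m P (full_blocks m)) -> is_ncp n P.
Proof.
move=> hi /andP[/is_partitionP[C0 tC cC] /noncrossingP nC].
have inC A : A \in P -> shift_block i m A \in comp_blocks i m P (full_blocks m).
  by move=> AP; rewrite inE in_imfset.
have le_shift x : (0 < shift i m x <= n + m) = (0 < x <= n).
  by rewrite /shift; case: ifP; lia.
apply/andP; split.
  apply/is_partitionP; split.
  - by apply: contra C0 => /inC; rewrite /shift_block imfset0.
  - move=> A B x AP BP xA xB; apply: (@shift_block_inj i m).
    by apply: (tC _ _ (shift i m x)); rewrite ?inC ?mem_shift_block.
  - move=> x; rewrite -le_shift; split=> [/cC[_ /fsetUP[]/imfsetP[A /= AP ->]]|].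
    + by rewrite mem_shift_block => xA; exists A.
    + have [m_gt0 ->] := mem_full_blocks AP.
      move=> /imfsetP[y /=]; rewrite in_interval => y_m eq_xy; exfalso; move: eq_xy.
      by rewrite /shift; do 2!case: ifP; lia.
    + case=> A AP xA; apply/cC; exists (shift_block i m A); first exact: inC.
      by rewrite mem_shift_block.
apply/noncrossingP => A B AP BP a a' b b' aA a'A bB b'B ab ba' a'b'.
apply: (@shift_block_inj i m).
by apply: (nC _ _ (inC _ AP) (inC _ BP) (shift i m a) (shift i m a')
  (shift i m b) (shift i m b')); rewrite ?mem_shift_block ?ltn_shift.
Qed.

(** If i is the largest minimum of a block A, an element strictly inside the
    span of A but not in A would lie in a block that also has an element below
    i, and that block would cross A. *)
Lemma last_block_interval n (P : {fset {fset nat}}) A i : is_ncp n P ->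
  A \in P -> is_min i A -> (forall B, B \in P -> exists2 x, x \in B & x <= i) ->
  exists m, [/\ 0 < m, i + m <= n.+1 & forall x, (x \in A) = (i <= x < i + m)].
Proof.
move=> /andP[/is_partitionP[P0 tP cP] /noncrossingP nP] AP [iA min_i] low.
have bound x : x \in A -> 0 < x <= n by move=> xA; apply/cP; exists A.
have ubA x : x \in A -> x <= n by move=> /bound /andP[].
have exA : exists x, x \in A by exists i.
have [M MA maxM] := ex_maxnP exA ubA.
have le_iM := min_i _ MA; have le_Mn := ubA _ MA; have /andP[i_gt0 _] := bound _ iA.
exists (M - i).+1; split=> //; first by lia.
move=> x; apply/idP/idP => [xA | x_iM].
  by have := min_i _ xA; have := maxM _ xA; lia.
have [B BP xB] : exists2 B, B \in P & x \in B by apply/cP; lia.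
have [-> // | ne_xi] := eqVneq x i; have [-> // | ne_xM] := eqVneq x M.
have [z zB le_zi] := low _ BP.
have [eq_zi | ne_zi] := eqVneq z i.
  by rewrite (tP A B i) // -eq_zi.
by rewrite -(nP B A BP AP z x i M) //; lia.
Qed.

(** Induction on the number of gaps allowed to be the minimum of a block; the
    bits are arbitrary, hence prescribed.  If the last of these gaps is not a
    minimum, its letter has first component 0; otherwise its block is an
    interval, and closing up the positions exhibits the partition as a
    composite. *)
Lemma blocks_surj (bs : seq bool) n (P : {fset {fset nat}}) :
  is_ncp n P -> size bs <= n.+1 ->
  (forall A, A \in P -> exists2 x, x \in A & x <= size bs) ->
  exists w, [/\ admissible w, weight w = n, unzip2 w = bs & blocks w = P].
Proof.
elim: bs n P => [|b bs IH] n P ncpP le_bs low.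
  have /andP[/is_partitionP[P0 tP cP] _] := ncpP.
  have Pfset0 : P = fset0.
    apply/eqP/fset0Pn => -[A AP]; have [x xA] := low _ AP.
    rewrite leqn0 => /eqP x0; rewrite {}x0 in xA.
    by have /cP : exists2 A, A \in P & 0 \in A by exists A.
  exists [::]; split=> //; rewrite ?Pfset0 //.
  case: n {ncpP le_bs} cP => // n /(_ 1)[/(_ isT)[A]].
  by rewrite Pfset0.
pose i := (size bs).+1.
have /andP[/is_partitionP[P0 tP cP] _] := ncpP.
have [/hasP[/= A AP /andP[iA /allP /= min_i]]|/hasPn/= nomin] :=
    boolP (has (fun A : {fset nat} => (i \in A) && all (leq i) A) P); last first.
  have [||w [aw ww bw <-]] := IH n P ncpP; first by rewrite /= in le_bs; lia.
    move=> A AP; have := nomin A AP; rewrite negb_and.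
    have [x xA] := low A AP; rewrite /= leq_eqVlt ltnS => /orP[/eqP eq_x|le_x].
      rewrite -/i in eq_x; rewrite -eq_x xA /= => /allPn[y yA].
      by rewrite -ltnNge eq_x ltnS => le_y; exists y.
    by exists x.
  have sw : size w = size bs by rewrite -bw size_map.
  exists ((0, b) :: w); split; rewrite /= ?aw ?sw ?ww ?bw ?comp_blocks0 //.
have [m [m_gt0 le_im eqA]] := last_block_interval ncpP AP (conj iA min_i) low.
pose unshift x := if x < i then x else x - m.
pose unshift_block (B : {fset nat}) := [fset unshift x | x in B].
pose P' : {fset {fset nat}} := [fset unshift_block B | B in P `\ A].
have unshiftK B : B \in P -> B != A ->
    shift_block i m (unshift_block B) = B.
  move=> BP neB.
  have shiftK x : x \in B -> shift i m (unshift x) = x.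
    move=> xB; have : x \notin A.
      by apply: contra neB => xA; rewrite (tP A B x).
    by rewrite eqA /unshift /shift; clear; repeat case: ifP; lia.
  apply/fsetP => x; apply/imfsetP/idP => [[_ /imfsetP[y /= yB ->] ->]|xB].
    by rewrite shiftK.
  by exists (unshift x); rewrite ?shiftK //; apply: in_imfset.
have PE : P = comp_blocks i m P' (full_blocks m).
  have intervalA : shift_block 1 i.-1 [fset x in iota 1 m] = A.
    apply/fsetP => x; rewrite eqA; apply/imfsetP/idP => [[y /=]|le_ix].
      by rewrite in_interval /shift => y_m ->; case: ifP; rewrite /i; lia.
    exists (x - i).+1; first by rewrite /= in_interval; lia.
    by rewrite /shift /=; rewrite /i in le_ix *; lia.
  apply/fsetP => B; apply/idP/fsetUP => [BP|[]/imfsetP[C /= CP ->]].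
  - have [-> | neB] := eqVneq B A.
      right; apply/imfsetP; exists [fset x in iota 1 m]; last by rewrite intervalA.
      exact: interval_full_block.
    left; apply/imfsetP; exists (unshift_block B); rewrite ?unshiftK //.
    by apply: in_imfset; rewrite !inE neB.
  - move: CP => /imfsetP[{}B /=]; rewrite !inE => /andP[neB BP] ->.
    by rewrite unshiftK.
  - by have [_ ->] := mem_full_blocks CP; rewrite intervalA.
have ncpP' : is_ncp (n - m) P'.
  apply: (@is_ncp_comp_left _ m i); first by rewrite /i in le_im *; lia.
  by rewrite -PE subnK //; lia.
have [||w [aw ww bw Pw]] := IH (n - m) P' ncpP'.
- by rewrite /i in le_im; lia.
- move=> C /imfsetP[B /= ]; rewrite !inE => /andP[neB BP] ->.
  have [x xB le_x] := low B BP; exists x; last first.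
    have : x != i by apply: contra neB => /eqP eq_x; rewrite (tP A B i) // -eq_x.
    by rewrite /= in le_x; rewrite /i; lia.
  apply/imfsetP; exists x => //; rewrite /unshift; case: ltnP => // le_ix.
  have eq_x : x = i by rewrite /= in le_x; rewrite /i in le_ix *; lia.
  by rewrite (tP A B i) ?eqxx // -?eq_x // in neB.
have sw : size w = size bs by rewrite -bw size_map.
exists ((m, b) :: w); split; rewrite /= ?aw ?sw ?bw ?Pw //.
- by rewrite ww; rewrite /i in le_im; lia.
- by move: ww; rewrite /weight /= => ->; lia.
Qed.

Lemma decode_surj n (x : pncp n) : exists w : word,
  [&& admissible w, weight w == n, size w == n.+1 & decode n w == x].
Proof.
case: x => P b.
have [||w [aw ww bw Pw]] := blocks_surj (bs := rev b) (valP P).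
- by rewrite size_rev size_tuple.
- move=> A AP; rewrite size_rev size_tuple.
  have /andP[/is_partitionP[P0 _ cP] _] := valP P.
  have [A0|[x xA]] := fset_0Vmem A; first by rewrite -A0 AP in P0.
  exists x => //; have /cP : exists2 A, A \in val P & x \in A by exists A.
  by lia.
have sw : size w = n.+1.
  by rewrite -[LHS](size_map snd) [map _ _]bw size_rev size_tuple.
exists w; rewrite aw ww sw !eqxx /=; apply/eqP/pncp_eqP => [|i lt_i].
  by rewrite val_decode.
rewrite nth_decode // -(nth_map _ false) ?size_rev ?sw // map_rev.
by rewrite [map _ w]bw revK.
Qed.

Local Open Scope ring_scope.

(** * The boundary of a word *)

Section Boundary.
Variable M : lmodType int.

Definition letter_boundary (f : letter -> M) (a : letter) : M :=
  if a is (m.+1, c) then f (m, c (+) true) + (-1) ^+ m *: f (m, c) else 0.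

(** The formal boundary D of a word is never built; [boundary f w] is the value
    on it of the linear extension of f.  The truncated subtraction in the sign
    is harmless, since [size u <= weight u] for the tail u of an admissible
    word. *)
Fixpoint boundary (f : word -> M) (w : word) : M :=
  if w is a :: u then
    (if (size u < weight u)%N then boundary (fun v => f (a :: v)) u else 0)
    + (-1) ^+ (weight u - size u) *: letter_boundary (fun a' => f (a' :: u)) a
  else 0.

Lemma eq_letter_boundary (f g : letter -> M) a :
  (forall m c c', a = (m.+1, c) -> f (m, c') = g (m, c')) ->
  letter_boundary f a = letter_boundary g a.
Proof. by case: a => [[|m] c] //= eq_fg; rewrite !(eq_fg m c). Qed.

Lemma letter_boundaryD (f g : letter -> M) a :
  letter_boundary (fun x => f x + g x) a
    = letter_boundary f a + letter_boundary g a.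
Proof. by case: a => [[|m] c] /=; rewrite ?addr0 // scalerDr addrACA. Qed.

Lemma letter_boundaryZ k (f : letter -> M) a :
  letter_boundary (fun x => k *: f x) a = k *: letter_boundary f a.
Proof.
by case: a => [[|m] c] /=; rewrite ?scaler0 // scalerDr !scalerA mulrC.
Qed.

Lemma letter_boundaryK (f : letter -> M) a :
  letter_boundary (letter_boundary f) a = 0.
Proof.
case: a => [[|[|m]] c] //=; first by rewrite scaler0 addr0.
rewrite exprS mulN1r scaleNr scalerDr scalerA -expr2 sqrr_sign scale1r.
by rewrite -addbA addbF opprD addrA addrK subrr.
Qed.

(** The words that occur in a boundary keep the size and the admissibility and
    lose one unit of weight, so functions need to agree on such words only. *)
Lemma eq_boundary (f g : word -> M) u :
  (forall v, size v = size u -> (weight v).+1 = weight u ->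
     (admissible u -> admissible v) -> f v = g v) ->
  boundary f u = boundary g u.
Proof.
elim: u f g => [|a u IH] f g eq_fg //=; congr (_ + _ *: _).
  case: ltnP => // lt_u; apply: IH => v sv wv av; apply: eq_fg => //=.
  - by rewrite sv.
  - by move: wv; rewrite /weight /=; lia.
  - by case/andP=> /av -> _; rewrite sv; lia.
by apply: eq_letter_boundary => m c c' eq_a; apply: eq_fg; rewrite ?eq_a.
Qed.

Lemma boundary0 u : boundary (fun=> 0) u = 0.
Proof.
elim: u => //= a u IH; rewrite IH if_same add0r.
by case: a => [[|m] c] /=; rewrite ?scaler0 ?addr0 ?scaler0.
Qed.

Lemma boundaryD (f g : word -> M) u :
  boundary (fun v => f v + g v) u = boundary f u + boundary g u.
Proof.
elim: u f g => [|a u IH] f g /=; first by rewrite addr0.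
rewrite letter_boundaryD scalerDr IH.
by case: ifP => _; rewrite ?add0r // addrACA.
Qed.

Lemma boundaryZ k (f : word -> M) u :
  boundary (fun v => k *: f v) u = k *: boundary f u.
Proof.
elim: u f => [|a u IH] f /=; first by rewrite scaler0.
rewrite letter_boundaryZ scalerDr IH !scalerA mulrC.
by case: ifP => _; rewrite ?scaler0.
Qed.

Lemma boundary_letter_boundary (g : letter -> word -> M) a u :
  boundary (fun v => letter_boundary (fun a' => g a' v) a) u
    = letter_boundary (fun a' => boundary (g a') u) a.
Proof.
case: a => [[|m] c] /=; first exact: boundary0.
by rewrite boundaryD boundaryZ.
Qed.

(** The two mixed terms, boundary in u and then in the last letter or the
    other way round, cancel because the height of u drops by one in the first
    case; what is left is a double boundary of u or of a letter. *)
Lemma boundaryK (f : word -> M) w : boundary (boundary f) w = 0.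
Proof.
elim: w f => [|a u IH] f //=.
rewrite letter_boundaryD letter_boundaryZ letter_boundaryK scaler0 addr0.
have [lt_u|_] := ltnP; last first.
  by case: a => [[|m] c]; rewrite /= !(scaler0, addr0).
rewrite -(boundary_letter_boundary (fun a' v => f (a' :: v))).
have -> : boundary (fun v => boundary f (a :: v)) u
    = boundary (fun v =>
        (if ((size u).+1 < weight u)%N then boundary (fun v' => f (a :: v')) v
         else 0)
        + - (-1) ^+ (weight u - size u)
          *: letter_boundary (fun a' => f (a' :: v)) a) u.
  apply: eq_boundary => v sv wv _ /=; rewrite sv -wv ltnS; congr (_ + _ *: _).
  by rewrite subSn ?exprS ?mulN1r ?opprK //; lia.
rewrite boundaryD boundaryZ scaleNr addrNK.
by case: (_ < _)%N; [exact: IH | exact: boundary0].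
Qed.

(** The height stays positive before each of the r blanks, which therefore
    contribute nothing of their own. *)
Lemma boundary_pad (f : word -> M) r u :
  (r <= weight u - size u)%N ->
  boundary f (pad r u) = boundary (fun v => f (pad r v)) u.
Proof.
elim: r f => [|r IH] f // le_r.
rewrite padS /= scaler0 addr0 weight_pad size_pad ifT; last by lia.
by rewrite IH //; lia.
Qed.

End Boundary.

Lemma raddf_boundary (M N : lmodType int) (phi : {additive M -> N})
    (f : word -> M) u :
  phi (boundary f u) = boundary (fun v => phi (f v)) u.
Proof.
elim: u f => [|a u IH] f /=; first exact: raddf0.
rewrite raddfD raddfZsign fun_if raddf0 IH; congr (_ + _ *: _).
by case: a => [[|m] c] /=; rewrite ?raddf0 ?raddfD ?raddfZsign.
Qed.

(** * The differential *)

Definition encode n (x : pncp n) : word := xchoose (decode_surj x).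

Lemma encodeP n (x : pncp n) :
  [/\ admissible (encode x), weight (encode x) = n, size (encode x) = n.+1
    & decode n (encode x) = x].
Proof. by case/and4P: (xchooseP (decode_surj x)) => ? /eqP ? /eqP ? /eqP. Qed.

Definition pword n (w : word) : E n.+1 := pgen (decode n w).

Lemma pword_pad n r w : pword n (pad r w) = pword n w.
Proof. by rewrite /pword decode_pad. Qed.

Lemma castE_pword a b (e : a.+1 = b.+1) w :
  castE e (pword a w) = pword b w.
Proof.
have [eq_ab] := e; move: e; rewrite -eq_ab => e.
by rewrite (eq_axiomK e).
Qed.

Lemma castED m n (e : m = n) u v : castE e (u + v) = castE e u + castE e v.
Proof. by case: n / e. Qed.

Lemma castEZ m n (e : m = n) k u : castE e (k *: u) = k *: castE e u.
Proof. by case: n / e. Qed.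

(** Meant for complete words, whose last letter is (0, c): the sign accounts
    for [psi 0 c] and for a final factor [psi 0 true] at the last position. *)
Definition word_diff n (w : word) : E n :=
  (-1) ^+ (head blank w).2 *:
  match n with
  | 0 => @gen 0 et - @gen 0 es
  | n'.+1 => boundary (pword n') (behead w)
  end.

Definition diff n (x : pncp n) : E n := word_diff n (encode x).

Lemma diff_decode n w : admissible w -> weight w = n -> size w = n.+1 ->
  diff (decode n w) = word_diff n w.
Proof.
move=> aw ww sw; have [ae we se de] := encodeP (decode n w).
by congr word_diff; apply: decode_inj de.
Qed.

(** A partition of degree n+1 whose rightmost decomposition avoids the last
    gap is spelled by a word u that is too short by at least one letter; the
    boundary of u is then its differential without any sign. *)
Lemma diff_open n u : admissible u -> weight u = n.+1 -> (size u <= n.+1)%N ->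
  diff (decode n.+1 u) = boundary (pword n) u.
Proof.
move=> au wu le_u; rewrite -(decode_pad _ (n.+2 - size u)) diff_decode.
- rewrite /word_diff subSn // padS /= expr0 scale1r boundary_pad ?wu //.
  by apply: eq_boundary => v _ _ _; rewrite pword_pad.
- by apply: admissible_pad => //; rewrite wu subnK //; lia.
- by rewrite weight_pad.
- by rewrite size_pad subnK //; lia.
Qed.

Lemma diff_closed n u c : admissible u -> weight u = n.+1 -> size u = n.+1 ->
  diff (decode n.+1 ((0%N, c) :: u)) = (-1) ^+ c *: boundary (pword n) u.
Proof. by move=> au wu su; rewrite diff_decode //= ?au ?wu ?su //=; lia. Qed.

Lemma diff_psi0 c : diff (psi 0 c) = (-1) ^+ c *: (@gen 0 et - @gen 0 es).
Proof. by rewrite psiE diff_decode. Qed.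

Lemma diff_psiS m c :
  diff (psi m.+1 c) = pgen (psi m (c (+) true)) + (-1) ^+ m *: pgen (psi m c).
Proof.
rewrite psiE diff_open //=; last by rewrite [LHS]addn0.
by rewrite add0r expr0 scale1r /pword -!psiE.
Qed.

Lemma extend_gen n (M : lmodType int) (f : basis n -> M) x :
  extend f (gen x) = f x.
Proof. by rewrite /extend /gen liftU scale1r. Qed.

Lemma ecomp_gen n m i (hi : (0 < i <= n.+1)%N) (x : pncp n) (y : pncp m) :
  ecomp hi (pgen x) (pgen y) = pgen (pncp_comp hi x y).
Proof. by rewrite /ecomp !extend_gen. Qed.

Lemma ecomp_boundaryl n m i (hi : (0 < i <= n.+1)%N) f u v :
  ecomp hi (boundary f u) v = boundary (fun w => ecomp (m := m) hi (f w) v) u.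
Proof. exact: raddf_boundary. Qed.

Lemma ecompDr n m i (hi : (0 < i <= n.+1)%N) (x : pncp n) (u v : E m.+1) :
  ecomp hi (pgen x) (u + v) = ecomp hi (pgen x) u + ecomp hi (pgen x) v.
Proof. by rewrite /ecomp !extend_gen raddfD. Qed.

Lemma ecompZr n m i (hi : (0 < i <= n.+1)%N) (x : pncp n) k (u : E m.+1) :
  ecomp hi (pgen x) ((-1) ^+ k *: u) = (-1) ^+ k *: ecomp hi (pgen x) u.
Proof. by rewrite /ecomp !extend_gen raddfZsign. Qed.

Lemma ecomp_diff_psiS n m i (hi : (0 < i <= n.+1)%N) u c l
    (e : (n + m).+1 = l.+1) :
  admissible u -> weight u = n -> size u = i.-1 ->
  castE e (ecomp hi (pgen (decode n u)) (diff (psi m.+1 c)))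
    = letter_boundary (fun a => pword l (a :: u)) (m.+1, c).
Proof.
move=> au wu su; rewrite diff_psiS ecompDr ecompZr !ecomp_gen.
by rewrite !pncp_comp_decode // castED castEZ !castE_pword.
Qed.

Lemma castE_boundary a b (e : a.+1 = b.+1) u :
  castE e (boundary (pword a) u) = boundary (pword b) u.
Proof.
have [eq_ab] := e; move: e; rewrite -eq_ab => e.
by rewrite (eq_axiomK e).
Qed.

(** This is why the inner clauses compute correctly: the terms of the boundary
    of u have as many letters as u, so their bit at gap i is still blank and
    composing with [psi m c] adds the same letter to each of them. *)
Lemma ecomp_boundary_psi n m i (hi : (0 < i <= n.+1)%N) u c :
  admissible u -> weight u = n.+1 -> size u = i.-1 ->
  ecomp hi (boundary (pword n) u) (pgen (psi m c))
    = boundary (fun v => pword (n + m) ((m, c) :: v)) u.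
Proof.
move=> au wu su; rewrite ecomp_boundaryl; apply: eq_boundary => v sv wv av.
rewrite ecomp_gen pncp_comp_decode ?av ?sv //.
by move: wv; rewrite wu => -[].
Qed.

(** For j <= n, these are the partitions to which a last factor of a rightmost
    decomposition can be attached at position j+1. *)
Definition spelled n (p : pncp n) j : Prop :=
  exists u, [/\ admissible u, weight u = n, size u = j & decode n u = p].

Lemma rightmost_spelled n (p : pncp n) l j : rightmost_decomposition p l ->
  all (fun f : nat * nat * bool => (f.1.1 <= j)%N) l -> (j <= n.+1)%N ->
  spelled p j.
Proof.
move=> rd; elim: rd j => [|{}n {}p {}l i m c hi _ IH lt_l nz] j.
  move=> _ le_j; exists (pad j [::]); split.
  - by apply: admissible_pad => //; rewrite addn0.
  - exact: weight_pad.
  - by rewrite size_pad addn0.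
  - by rewrite decode_pad psiE -(decode_pad 0 1).
rewrite all_rcons /= => /andP[le_ij _] le_j; have [i_gt0 le_i] := andP hi.
have [||u [au wu su <-]] := IH i.-1; last 1 first.
- exists (pad (j - i) ((m, c) :: u)); split.
  + apply: admissible_pad; rewrite /= ?au ?su ?wu /=; first by lia.
    by rewrite weight_cons wu; lia.
  + by rewrite weight_pad weight_cons wu.
  + by rewrite size_pad /= su; lia.
  + by rewrite decode_pad pncp_comp_decode.
- by apply: sub_all lt_l => f /=; lia.
- lia.
Qed.

Lemma rightmost_rcons n (p : pncp n) l f : rightmost_decomposition p (rcons l f) ->
  all (fun g : nat * nat * bool => (g.1.1 < f.1.1)%N) l.
Proof.
have: forall l', rightmost_decomposition p l' -> l' = rcons l f ->
  all (fun g : nat * nat * bool => (g.1.1 < f.1.1)%N) l.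
  move=> l' [|{}n {}p {}l' i m c hi rd lt_l nz]; first by case: l.
  by move/rcons_inj => [<- <-].
by move=> H /H; apply.
Qed.

Lemma final_factor_spelled n i (hi : (0 < i <= n.+1)%N) (p : pncp n) m c :
  final_factor hi p m c -> spelled p i.-1.
Proof.
move=> [l rd /rightmost_rcons lt_l]; apply: rightmost_spelled rd _ _.
  by apply: sub_all lt_l => f /=; lia.
by lia.
Qed.

Lemma diff_clauses : differential_clauses diff.
Proof.
split.
- exact: diff_psi0.
- exact: diff_psiS.
(* At the last position the word without its last letter has height 0, so
   only that letter is differentiated. *)
- move=> k p hi /final_factor_spelled[u [au wu su <-]].
  rewrite pncp_comp_decode // (@diff_closed (k + 0)) ?wu ?su ?addn0 //.
  rewrite diff_open ?su // -scaleN1r castEZ expr1; congr (_ *: _).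
  exact/esym/castE_boundary.
- move=> k m c p hi /final_factor_spelled[u [au wu su <-]].
  rewrite pncp_comp_decode // (@diff_open (k + m.+1)).
  + rewrite ecomp_diff_psiS // [LHS]/= su wu ltnn subnn add0r expr0 scale1r.
    by [].
  + by rewrite /= au wu su /=.
  + by rewrite weight_cons wu.
  + by rewrite /= su /=; lia.
(* At an inner position that height is positive: both summands survive. *)
- move=> k i p hi hi' /final_factor_spelled[u [au wu su <-]].
  rewrite pncp_comp_decode // (@diff_open (k + 0)).
  + rewrite (diff_open _ wu) ?ecomp_boundary_psi ?wu //; last by lia.
    by rewrite [LHS]/= scaler0 addr0 ifT // su wu; lia.
  + by rewrite /= au wu su /=; lia.
  + by rewrite weight_cons wu.
  + by rewrite /= su /=; lia.
- move=> k m i c p hi hi' /final_factor_spelled[u [au wu su <-]].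
  rewrite pncp_comp_decode // (@diff_open (k + m.+1)).
  + rewrite (diff_open _ wu) ?ecomp_boundary_psi ?wu //; last by lia.
    rewrite ecomp_diff_psiS // [LHS]/= ifT; last by rewrite su wu; lia.
    by congr (_ + _ ^+ _ *: _); rewrite su wu; lia.
  + by rewrite /= au wu su /=; lia.
  + by rewrite weight_cons wu.
  + by rewrite /= su /=; lia.
Qed.

Lemma decode_nil : decode 0 [::] = psi 0 false.
Proof. by rewrite psiE; exact/esym/(decode_pad 0 1 [::]). Qed.

(** Building u letter by letter, and skipping the blanks, performs the
    compositions of a rightmost decomposition. *)
Lemma decode_rightmost u : admissible u -> (size u <= (weight u).+1)%N ->
  exists2 l, rightmost_decomposition (decode (weight u) u) l
    & all (fun f : nat * nat * bool => (f.1.1 <= size u)%N) l.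
Proof.
elim: u => [|[m c] u IH] /=.
  by exists [::]; rewrite // decode_nil; constructor.
move=> /andP[au le_u] _; have [|l rd le_l] := IH au; first exact: leqW.
have lt_l : all (fun f : nat * nat * bool => (f.1.1 < (size u).+1)%N) l by [].
rewrite weight_cons.
case nz: ((0 < m) || c)%N; last first.
  case: m c nz => [|m] // [] // _; exists l; last by apply: sub_all le_l => f; lia.
  by rewrite addn0 (decode_pad _ 1).
have hi : (0 < (size u).+1 <= (weight u).+1)%N by [].
exists (rcons l ((size u).+1, m, c)).
  by rewrite -(pncp_comp_decode m hi) //; constructor.
by rewrite all_rcons leqnn; apply: sub_all le_l => f; lia.
Qed.

Lemma final_factor_decode u m c (hi : (0 < (size u).+1 <= (weight u).+1)%N) :
  admissible u -> (0 < m)%N || c -> final_factor hi (decode (weight u) u) m c.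
Proof.
move=> au nz; have [|l rd le_l] := decode_rightmost au; first by lia.
by exists l => //; constructor.
Qed.

(** The right-hand side of each clause involves d only at p and at [psi m c],
    where [d_psi0] and [d_psiS] prescribe it. *)
Lemma differential_clauses_comp d d' k i (hi : (0 < i <= k.+2)%N)
    (p : pncp k.+1) m c :
  differential_clauses d -> differential_clauses d' ->
  final_factor hi p m c -> (0 < m)%N || c -> d k.+1 p = d' k.+1 p ->
  d (k.+1 + m)%N (pncp_comp hi p (psi m c))
    = d' (k.+1 + m)%N (pncp_comp hi p (psi m c)).
Proof.
move=> dP dP' ff nz eq_p.
have [eq_i | ne_i] := eqVneq i k.+2.
  subst i.
  case: m c nz ff => [[] // _|m c _] ff.
    by rewrite (d_last_psi0 dP ff) (d_last_psi0 dP' ff) eq_p.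
  by rewrite (d_last_psiS dP ff) (d_last_psiS dP' ff) (d_psiS dP) (d_psiS dP').
have hi' : (0 < i <= k.+1)%N by lia.
case: m c nz ff => [[] // _|m c _] ff.
  by rewrite (d_inner_psi0 dP hi' ff) (d_inner_psi0 dP' hi' ff) eq_p.
rewrite (d_inner_psiS dP hi' ff) (d_inner_psiS dP' hi' ff).
by rewrite (d_psiS dP) (d_psiS dP') eq_p.
Qed.

Lemma differential_clauses_unique d d' :
  differential_clauses d -> differential_clauses d' ->
  forall n (x : pncp n), d n x = d' n x.
Proof.
move=> dP dP' n x; have [aw ww sw <-] := encodeP x.
have {sw} : (size (encode x) <= (weight (encode x)).+1)%N by rewrite sw ww.
move: (encode x) aw ww => w; elim: w n {x} => [|[m c] u IH] n /=.
  by move=> _ <- _; rewrite decode_nil (d_psi0 dP) (d_psi0 dP').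
move=> /andP[au le_u]; rewrite weight_cons => <- _.
have {}IH :
    d (weight u) (decode (weight u) u) = d' (weight u) (decode (weight u) u).
  by apply: IH => //; lia.
case nz: ((0 < m) || c)%N; last first.
  by case: m c nz => [|m] // [] // _; rewrite (decode_pad _ 1) addn0.
have hi : (0 < (size u).+1 <= (weight u).+1)%N by [].
have [u0 | u_gt0] := posnP (weight u).
  have -> : u = [::] by apply: size0nil; lia.
  rewrite -psiE; case: m {nz} => [|m].
    by rewrite (d_psi0 dP) (d_psi0 dP').
  by rewrite (d_psiS dP) (d_psiS dP').
have := final_factor_decode hi au nz.
rewrite -(pncp_comp_decode m hi) //.
case: (weight u) u_gt0 hi (decode _ u) IH => // k _ hi p eq_p ff.
exact: differential_clauses_comp.
Qed.

Lemma extend_eq0 n (M : zmodType) (phi : {additive E n -> M}) :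
  (forall x : basis n, phi (gen x) = 0) -> forall u, phi u = 0.
Proof.
move=> phi0 u; rewrite -[u]freeg_sumE raddf_sum big1 // => x _.
have -> : << coeff x u *g x >> = gen x *~ coeff x u.
  by rewrite /gen freegU_mulz intz.
by rewrite (raddfMz phi) phi0 mul0rz.
Qed.

Lemma augmentation_diff x : augmentation (diff (n := 0) x) = 0.
Proof.
have aug_gen y : augmentation (@gen 0 y) = 1.
  exact: (@extend_gen 0 int^o (fun=> 1) y).
have aug_diff : augmentation (@gen 0 et - @gen 0 es) = 0.
  by rewrite raddfB !aug_gen subrr.
rewrite /diff /word_diff; case: (_.2); last by rewrite expr0 scale1r.
by rewrite expr1 scaleN1r raddfN aug_diff oppr0.
Qed.

(** The differential vanishes on the boundary of a word of height 0.  Its last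
    letter follows either a word of positive height, and is (0, c), so that
    [boundaryK] applies; or a word of height 0, and is (1, c), so that the two
    terms of its letter boundary cancel. *)
Lemma boundary_word_diff n u : admissible u -> weight u = n.+1 -> size u = n.+1 ->
  boundary (word_diff n) u = 0.
Proof.
case: u => [|[m c] u] //= /andP[au le_u]; rewrite weight_cons => wu [su].
case: ltnP => [lt_u | ge_u].
  have -> : m = 0%N by lia.
  rewrite scaler0 addr0 boundaryZ /=.
  case: n wu su => [|n] wu su; first by move/size0nil: su lt_u => ->.
  by rewrite boundaryK scaler0.
have -> : m = 1%N by lia.
rewrite add0r /word_diff /= expr0 scale1r.
by case: c {wu}; rewrite /= !(expr0, expr1, scale1r, scaleN1r) ?addNr ?subrr scaler0.
Qed.

Lemma diff_diff n (x : pncp n.+1) : differential (@diff) n (diff x) = 0.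
Proof.
have [aw ww sw <-] := encodeP x.
case: (encode x) aw ww sw => [|[m c] u] //= /andP[au le_u].
rewrite weight_cons => wu [su].
have m0 : m = 0%N by lia.
rewrite m0 addn0 in wu *.
rewrite diff_closed // raddfZsign raddf_boundary.
rewrite -[RHS](scaler0 _ ((-1) ^+ c)) -(boundary_word_diff au wu su).
congr (_ *: _); apply: eq_boundary => v sv wv av.
rewrite [LHS]extend_gen diff_decode ?av ?sv //.
by move: wv; rewrite wu => -[].
Qed.

Theorem proposition2p4 :
  exists d : forall n, pncp n -> E n,
    [/\ differential_clauses d,
        (forall d' : forall n, pncp n -> E n,
           differential_clauses d' -> forall n (x : pncp n), d' n x = d n x)
      & @is_augmented_chain_complex E (differential d) augmentation].
Proof.
exists diff; split; first exact: diff_clauses.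
  by move=> d' dP'; apply: differential_clauses_unique => //; exact: diff_clauses.
split=> [|n].
  apply: (extend_eq0 (phi := augmentation \o differential (@diff) 0)) => x.
  by rewrite /= extend_gen augmentation_diff.
apply: (extend_eq0
  (phi := differential (@diff) n \o differential (@diff) n.+1)) => x.
by rewrite /= extend_gen diff_diff.
Qed.
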